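(* The roots in $\mathbb{C}$ of any SNN polynomial of degree $2$ are contained in \[[-3,2]\cup\left\{x+iy\in\mathbb{C}: x,y\in\mathbb{R},\ y^2\leq -x^2-x+\tfrac12\right\},\] where $[-3,2]$ denotes the real interval.
   Context: For an integer $k$ and a positive integer $d$, $\binom{t+k}{d}$ denotes the polynomial $\frac{(t+k)(t+k-1)\cdots(t+k-d+1)}{d!}$ in $t$. Every polynomial $f$ of degree $d$ over $\mathbb{C}$ can be written uniquely as $f(t)=\sum_{j=0}^d h_j^*\binom{t+d-j}{d}$ with $h_j^*\in\mathbb{C}$ (equivalently $\sum_{t\ge 0}f(t)x^t=\frac{\sum_{j=0}^d h_j^*x^j}{(1-x)^{d+1}}$). A non-zero polynomial $f$ of degree $d$ is called Stanley non-negative (SNN) if $(h_0^*,\ldots,h_d^* )\in(\mathbb{R}_{\ge 0})^{d+1}$. *)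

(* Defs.v *)
From mathcomp Require Import all_boot all_order all_algebra.
From mathcomp Require Import reals complex.

Set Implicit Arguments.
Unset Strict Implicit.
Unset Printing Implicit Defensive.

Import Order.TTheory GRing.Theory Num.Theory.

Local Open Scope ring_scope.
Local Open Scope complex_scope.

(* binom(t + k, d) = (t + k) (t + k - 1) ... (t + k - d + 1) / d! *)
Definition binom_poly (F : fieldType) (k : int) (d : nat) : {poly F} :=
  (d`!%:R)^-1 *: \prod_(i < d) ('X + ((k - i%:Z)%:~R)%:P).

Definition hstar_vector (F : fieldType) (d : nat) (f : {poly F})
    (h : 'I_d.+1 -> F) : Prop :=
  f = \sum_(j < d.+1) h j *: binom_poly F (d%:Z - j%:Z) d.

(* The h^*-vector is unique, so the existential just names it. In the order
   of R[i], 0 <= z means that z is real and non-negative. *)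
Definition SNN (R : realType) (f : {poly R[i]}) : Prop :=
  f != 0 /\
  exists2 h : 'I_(size f).-1.+1 -> R[i],
    hstar_vector f h & forall j, 0 <= h j.

(* Main.v *)
(* Up to a factor 2, f = a (t+2)(t+1) + b (t+1)t + c t(t-1) with a, b, c >= 0 not
   all zero. Each summand is positive for real t outside [-2,1]. A non-real root
   x + iy satisfies x^2 + y^2 = 2a/S and -2x = (3a+b-c)/S, where S = a+b+c, and
   then 1/2 - x - (x^2 + y^2) = b/S >= 0. *)
Require Import Defs.
From mathcomp Require Import all_boot all_order all_algebra.
From mathcomp Require Import reals complex.
From mathcomp Require Import ring lra.

Import Order.TTheory GRing.Theory Num.Theory.
Local Open Scope ring_scope.
Local Open Scope complex_scope.

Lemma binom_poly2_horner (F : fieldType) (k : int) (z : F) :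
  (binom_poly F k 2).[z] = 2^-1 * ((z + k%:~R) * (z + (k - 1)%:~R)).
Proof.
by rewrite /binom_poly hornerZ !big_ord_recr big_ord0 /= mul1r !hornerE.
Qed.

Lemma hstar2_real_root (R : realFieldType) (a b c x : R) :
    0 <= a -> 0 <= b -> 0 <= c -> 0 < a + b + c ->
    a * ((x + 2) * (x + 1)) + b * ((x + 1) * x) + c * (x * (x - 1)) = 0 ->
  -2 <= x <= 1.
Proof.
move=> a0 b0 c0 S0 eq0.
have pos : 0 < (x + 2) * (x + 1) -> 0 < (x + 1) * x -> 0 < x * (x - 1) -> False.
  move=> P0 Q0 T0.
  have := mulr_ge0 a0 (ltW P0); have := mulr_ge0 b0 (ltW Q0).
  have := mulr_ge0 c0 (ltW T0) => cT bQ aP.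
  (* Three non-negative terms sum to zero, so none is positive; cancelling the positive factors
     gives [a, b, c <= 0], against [0 < a + b + c]. *)
  have : a * ((x + 2) * (x + 1)) <= 0 by lra.
  have : b * ((x + 1) * x) <= 0 by lra.
  have : c * (x * (x - 1)) <= 0 by lra.
  by rewrite (pmulr_lle0 _ P0) (pmulr_lle0 _ Q0) (pmulr_lle0 _ T0); lra.
by apply/andP; split; rewrite leNgt; apply/negP => hx; apply: pos; nra.
Qed.

(** The two equations are the real and imaginary parts of [S z^2 + (3a+b-c) z + 2a = 0] at
    [z = x + iy], with [S = a + b + c]. *)
Lemma hstar2_nonreal_root (R : realFieldType) (a b c x y : R) :
    0 <= b -> 0 < a + b + c -> y != 0 ->
    (a + b + c) * (x ^+ 2 - y ^+ 2) + (3 * a + b - c) * x + 2 * a = 0 ->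
    y * (2 * (a + b + c) * x + (3 * a + b - c)) = 0 ->
  y ^+ 2 <= - x ^+ 2 - x + 1 / 2.
Proof.
move=> b0 S0 y0 re0 /eqP; rewrite mulf_eq0 (negPf y0) /= => /eqP im0.
rewrite -subr_ge0 -(pmulr_rge0 _ S0).
suff -> : (a + b + c) * (- x ^+ 2 - x + 1 / 2 - y ^+ 2) = b by [].
(* Subtracting [re0] from this multiple of [im0] leaves [S (x^2 + y^2) = 2a], so the goal becomes
   linear in the monomials. *)
have : x * (2 * (a + b + c) * x + (3 * a + b - c)) = 0 by rewrite im0 mulr0.
lra.
Qed.

Theorem theorem4p2 (R : realType) (f : {poly R[i]}) (hdeg : size f = 3%N)
    (hf : SNN f) (z : R[i]) (hz : root f z) :
  (complex.Im z = 0 /\ -3 <= complex.Re z <= 2) \/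
  complex.Im z ^+ 2 <= - complex.Re z ^+ 2 - complex.Re z + 1 / 2.
Proof.
move: hf; rewrite /SNN hdeg /= => -[f0 [h hE h0]].
move: hE; rewrite /hstar_vector !big_ord_recl big_ord0 !addr0 => fE.
move: fE (h0 ord0) (h0 (lift ord0 ord0)) (h0 (lift ord0 (lift ord0 ord0))).
case: (h ord0) (h (lift ord0 ord0)) (h (lift ord0 (lift ord0 ord0)))
  => [a a'] [b b'] [c c'] fE.
rewrite !lecE /= => /andP[/eqP a'0 a0] /andP[/eqP b'0 b0] /andP[/eqP c'0 c0].
move: fE; rewrite a'0 b'0 c'0 => {a' b' c' a'0 b'0 c'0} fE.
have S0 : 0 < a + b + c.
  (* Non-negative coefficients with zero sum all vanish, which would force [f = 0]. *)
  rewrite lt_neqAle !addr_ge0 // andbT eq_sym; apply: contraNneq f0 => S0.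
  have [az bz cz] : [/\ a = 0, b = 0 & c = 0] by split; lra.
  by rewrite fE az bz cz !scale0r !addr0.
have : a%:C * ((z + 2) * (z + 1)) + b%:C * ((z + 1) * z)
    + c%:C * (z * (z - 1)) = 0.
  (* Multiplying by [1/2] restores the [1/2!] of each [binom_poly] and turns the left side into
     [f.[z]]. *)
  have two0 : (2 : R[i])^-1 != 0 by rewrite invr_eq0 pnatr_eq0.
  apply: (mulfI two0); rewrite mulr0 -[RHS](rootP hz) fE !hornerD.
  rewrite ![(_ *: binom_poly _ _ _).[_]]hornerZ.
  rewrite !binom_poly2_horner /= -/(a%:C) -/(b%:C) -/(c%:C).
  (* The [bump] terms are the indices [j = 1, 2] left by peeling off the sum, giving the shifts
     [d - j = 1, 0]. *)
  have -> : 2%:Z - (bump 0 0)%:Z = 1 by [].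
  have -> : 2%:Z - (bump 0 (bump 0 0))%:Z = 0 by [].
  by ring.
case: z {hz} => x y /eqP; rewrite eq_complex /= => /andP[/eqP re0 /eqP im0].
have [y0|y0] := eqVneq y 0.
  left; split=> //.
  have : -2 <= x <= 1.
    by apply: (@hstar2_real_root _ a b c) => //; rewrite -re0 y0; ring.
  by move=> /andP[? ?]; apply/andP; split; lra.
right; apply: (@hstar2_nonreal_root _ a b c) => //.
  by rewrite -re0; ring.
by rewrite -im0; ring.
Qed.
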